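(* Let $0<\beta\le 1/2$, $0<p<1$, $q=1-p$, with $(\beta,p)\neq(1/2,1/2)$. Let $(X_k)_{k\ge 0}$ be the autoregressive process $X_{k+1}=\beta X_k+\varepsilon_{k+1}$, $k\ge 0$, where $(\varepsilon_k)_{k\ge1}$ are i.i.d. with $\mathbb{P}(\varepsilon_k=0)=p$ and $\mathbb{P}(\varepsilon_k=1-\beta)=q$, and where $X_0$ is independent of $(\varepsilon_k)_{k\ge 1}$ and has distribution function $F_{\beta,p}$ (so that every $X_k$ has distribution function $F_{\beta,p}$). Let $M_n=\max\{X_0,\dots,X_{n-1}\}$, and put $a_n=1/\beta^n$, $b_n=1$, $k_n=\lfloor 1/q^n\rfloor$. Then for all $x<0$ $$\lim_{n\to\infty}\mathbb{P}\big(a_n(M_{k_n}-b_n)\le x\big)=\exp\big\{-p\,(-x)^{\log q/\log\beta}\,\nu_{\beta,q}(\log(-x))\big\}.$$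
   Context: For $0<\beta\le1/2$, $0<p<1$, $q=1-p$, $F_{\beta,p}$ denotes the unique distribution function on $\mathbb{R}$ satisfying $F(x)=pF(x/\beta)+qF(x/\beta+1-1/\beta)$ for all $x\in\mathbb{R}$; it vanishes on $(-\infty,0]$, equals $1$ on $[1,\infty)$, and satisfies $F_{\beta,p}(x)=x^{\log p/\log\beta}\,\nu_{\beta,p}(\log x)$ for $0<x\le1$, where $\nu_{\beta,p}:\mathbb{R}\to\mathbb{R}$ is the function of period $|\log\beta|$ determined by $\nu_{\beta,p}(t)=e^{-t\log p/\log\beta}F_{\beta,p}(e^t)$ for $t\le0$. The functions $F_{\beta,q}$ and $\nu_{\beta,q}$ are the ones obtained by interchanging the roles of $p$ and $q$. *)

(* Defs.v *)
From HB Require Import structures.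
From mathcomp Require Import all_boot all_order all_algebra.
From mathcomp Require Import all_classical all_reals all_analysis.

Set Implicit Arguments.
Unset Strict Implicit.
Unset Printing Implicit Defensive.

Import Order.TTheory GRing.Theory Num.Theory.
Import numFieldNormedType.Exports.

Local Open Scope classical_set_scope.
Local Open Scope ring_scope.

Definition distribution_function {R : realType} (F : R -> R) : Prop :=
  [/\ {homo F : x y / x <= y}, right_continuous F,
      F @ -oo --> (0 : R) & F @ +oo --> (1 : R)].

Definition Feq {R : realType} (beta p : R) (F : R -> R) : Prop :=
  forall x, F x = p * F (x / beta) + (1 - p) * F (x / beta + 1 - 1 / beta).

(* For 0 < beta <= 1/2 and 0 < p < 1 there is exactly one such function;
   outside this range the value of F_ is irrelevant. *)
Definition F_ {R : realType} (beta p : R) : R -> R :=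
  xget (fun=> 0) [set F | distribution_function F /\ Feq beta p F].

(* Likewise the unique such function: F (beta x) = p F x for 0 < x <= 1 makes
   the formula on t <= 0 consistent with the period, and the period extends
   it to the whole line. *)
Definition nu_ {R : realType} (beta p : R) : R -> R :=
  xget (fun=> 0) [set nu | periodic nu `|ln beta| /\
    forall t, t <= 0 ->
      nu t = expR (- t * ln p / ln beta) * F_ beta p (expR t)].

Section independence.
Context {d : measure_display} {T : measurableType d} {R : realType}
  (P : probability T R).

Definition mutually_independent {I : eqType} (Y : I -> {RV P >-> R}) : Prop :=
  forall (s : seq I) (B : I -> set R), uniq s ->
    (forall i, measurable (B i)) ->
    (P (\bigcap_(i in [set` s]) (Y i @^-1` B i)) =
     \prod_(i <- s) P (Y i @^-1` B i))%E.

Definition sigma_family {I : Type} (Y : I -> {RV P >-> R}) : set (set T) :=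
  <<s \bigcup_i preimage_set_system [set: T] (Y i) measurable >>.

Definition independent_of_family {I : Type} (X : {RV P >-> R})
    (Y : I -> {RV P >-> R}) : Prop :=
  forall (A : set R) (B : set T), measurable A -> sigma_family Y B ->
    (P (X @^-1` A `&` B) = P (X @^-1` A) * P B)%E.

End independence.

(* For n >= 1 this is max {X 0, ..., X (n - 1)}: starting the iteration at X 0
   is then harmless. *)
Definition running_max {T : Type} {R : realType} (X : nat -> T -> R)
    (n : nat) (w : T) : R :=
  \big[Num.max/X 0%N w]_(i < n) X i w.

(* Main.v *)
(* Write q = 1 - p and Y = 1 - X. An innovation 1 - beta multiplies Y by beta
   and an innovation 0 moves Y to at least 1 - beta >= 1/2. Hence, for z <= 1,
   Y_k < beta^N z exactly when the last N innovations are 1 - beta and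
   Y_{k-N} < z, while a first exceedance of the level u = 1 - beta^N z
   moreover requires beta z <= Y_{k-N}. Let G_k(t) be the probability of
   X_0, ..., X_{k-1} <= u and X_k <= t. The one-step map contracts the distance
   between G_k and G_k(1) F by max(p, q), because beta <= 1/2 lets at most one
   of its two branches act, and killing costs O(q^N); so
   G_k = G_k(1) F + O(q^N). Consequently the survival probability
   phi_k = G_k(1) satisfies phi_{k+1} = (1 - c) phi_k + O(N q^{2N}) with
   c = q^N (F(1 - beta z) - F(1 - z)) = p q^N (1 - F(1 - z)), and over
   O(q^{-N}) steps it stays within O(N q^N) of e^{-ck}. Finally
   1 - F(1 - z) = F_{beta,q}(z), since x |-> 1 - F(1 - x) is continuous and
   solves the equation defining F_{beta,q}, whose solution is unique. *)
Require Import Defs.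
From HB Require Import structures.
From mathcomp Require Import all_boot all_order all_algebra.
From mathcomp Require Import all_classical all_reals all_analysis.
From mathcomp Require Import ring lra.

Set Implicit Arguments.
Unset Strict Implicit.
Unset Printing Implicit Defensive.

Import Order.TTheory GRing.Theory Num.Theory.
Import numFieldNormedType.Exports.

Local Open Scope classical_set_scope.
Local Open Scope ring_scope.

(** * Self-similar distribution functions *)

Lemma exists_expr_lt (R : realType) (r e : R) :
  0 <= r < 1 -> 0 < e -> exists n, r ^+ n < e.
Proof.
move=> /andP[r0 r1] e0.
have : r ^+ n @[n --> \oo] --> (0 : R) by apply: cvg_expr; rewrite ger0_norm.
by move=> /cvgr_lt/(_ _ e0) [n _ /(_ n (leqnn n))] h; exists n.
Qed.

Lemma le_expr_le0 (R : realType) (r x : R) :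
  0 <= r < 1 -> (forall n, x <= r ^+ n) -> x <= 0.
Proof.
move=> hr hx; rewrite leNgt; apply/negP => /(exists_expr_lt hr) [n].
by rewrite ltNge hx.
Qed.

Section self_similar.
Variables (R : realType) (beta p : R).
Hypotheses (beta_gt0 : 0 < beta) (beta_le : beta <= 1 / 2).
Hypotheses (p_gt0 : 0 < p) (p_lt1 : p < 1).

Let rho := Num.max p (1 - p).

Local Ltac params := move: (beta_gt0) (beta_le) (p_gt0) (p_lt1) => ? ? ? ?.

Lemma contraction_ratio_itv : 0 <= rho < 1.
Proof.
by rewrite /rho le_max gt_max (ltW p_gt0) p_lt1 /= ltrBlDr ltrDl.
Qed.

Lemma inv_beta_ge2 : 2 <= 1 / beta.
Proof. by move: (beta_gt0) (beta_le) => ? ?; rewrite ler_pdivlMr//; lra. Qed.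

(* Since [beta <= 1/2], at most one of the two arguments lies in [(0, 1)]. *)
Lemma self_similar_contraction (D : R -> R) (B : R) :
  (forall x, x <= 0 -> D x = 0) -> (forall x, 1 <= x -> D x = 0) ->
  (forall x, `|D x| <= B) ->
  forall x, `|p * D (x / beta) + (1 - p) * D (x / beta + 1 - 1 / beta)|
    <= rho * B.
Proof.
params.
move=> D0 D1 DB x; have B0 : 0 <= B by exact: le_trans (DB 0).
have i2 := inv_beta_ge2.
have [h|h] := leP 1 (x / beta).
  rewrite (D1 _ h) mulr0 add0r normrM; apply: ler_pM => //.
  by rewrite ger0_norm /rho ?le_max ?lexx ?orbT//; lra.
rewrite (D0 (_ + 1 - _)); last by lra.
rewrite mulr0 addr0 normrM; apply: ler_pM => //.
by rewrite ger0_norm /rho ?le_max ?lexx//; lra.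
Qed.

(** * Support, scaling and continuity of a solution *)

Section one_solution.
Variable F : R -> R.
Hypotheses (F_df : distribution_function F) (F_eq : Feq beta p F).

Let F_nd : {homo F : x y / x <= y}. Proof. by case: F_df. Qed.

Lemma df_ge0 x : 0 <= F x.
Proof.
have [_ _ F0 _] := F_df; rewrite leNgt; apply/negP => Fx.
have /filter_ex [y [+]] : \forall y \near -oo, F x < F y /\ y <= x.
  by apply: filterI; [exact: (cvgr_gt _ F0)|exact/nbhs_ninfty_le/num_real].
by move=> h /F_nd; rewrite leNgt h.
Qed.

Lemma df_le1 x : F x <= 1.
Proof.
have [_ _ _ F1] := F_df; rewrite leNgt; apply/negP => Fx.
have /filter_ex [y [+]] : \forall y \near +oo, F y < F x /\ x <= y.
  by apply: filterI; [exact: (cvgr_lt _ F1)|exact/nbhs_pinfty_ge/num_real].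
by move=> h /F_nd; rewrite leNgt h.
Qed.

(** [F x] averages two values of [F], and [x / beta] is the larger of their arguments. For [x < 0]
    the iterates run to minus infinity, which forces [F x = 0]. *)
Lemma self_similar_le x n : F x <= F (x / beta ^+ n).
Proof.
params.
elim: n => [|n IH]; first by rewrite expr0 divr1.
apply: (le_trans IH); rewrite [leLHS]F_eq exprSr invfM mulrA.
have := @F_nd (x / beta ^+ n / beta + 1 - 1 / beta) (x / beta ^+ n / beta).
have i2 := inv_beta_ge2.
by move=> /(_ ltac:(lra)); nra.
Qed.

(** Mirror image about 1, the fixed point of the second branch [x / beta + 1 - 1 / beta]: that
    branch has the smaller argument, and for [x > 1] its iterates run to plus infinity. *)
Lemma self_similar_ge x n : F (1 + (x - 1) / beta ^+ n) <= F x.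
Proof.
params.
elim: n => [|n IH]; first by rewrite expr0 divr1 addrC subrK.
apply: le_trans IH; rewrite [leRHS]F_eq exprSr invfM mulrA.
set y := (x - 1) / beta ^+ n.
have i2 := inv_beta_ge2.
have -> : (1 + y) / beta + 1 - 1 / beta = 1 + y / beta by rewrite mulrDl; ring.
have := @F_nd (1 + y / beta) ((1 + y) / beta).
have -> : (1 + y) / beta = 1 / beta + y / beta by rewrite mulrDl.
by move=> /(_ ltac:(lra)); nra.
Qed.

Let beta01 : 0 <= beta < 1. Proof. by params; lra. Qed.

Let F_lt0 x : x < 0 -> F x = 0.
Proof.
params.
move=> x0; apply/eqP; rewrite eq_le df_ge0 andbT.
apply/ler_addgt0Pr => e e0; rewrite add0r.
have [_ _ F0 _] := F_df.
have /filter_ex [y [y0 Fy]] : \forall y \near -oo, y < 0 /\ F y < e.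
  by apply: filterI; [exact/nbhs_ninfty_lt/num_real|exact: (cvgr_lt _ F0)].
have xy : 0 < x / y by rewrite nmulr_lgt0// invr_lt0.
have [n hn] := exists_expr_lt beta01 xy.
apply: (le_trans (self_similar_le x n)); apply/ltW/(le_lt_trans _ Fy)/F_nd.
rewrite ler_pdivrMr ?exprn_gt0//.
by move: hn; rewrite ltr_ndivlMr// => /ltW; rewrite mulrC.
Qed.

Let F_gt1 x : 1 < x -> F x = 1.
Proof.
params.
move=> x1; apply/eqP; rewrite eq_le df_le1 /=.
apply/ler_addgt0Pr => e e0; rewrite -lerBlDr.
have [_ _ _ F1] := F_df.
have /filter_ex [y [y0 Fy]] : \forall y \near +oo, 1 < y /\ 1 - e < F y.
  by apply: filterI; [exact/nbhs_pinfty_gt/num_real|apply: (cvgr_gt _ F1); lra].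
have xy : 0 < (x - 1) / y by apply: divr_gt0; lra.
have [n hn] := exists_expr_lt beta01 xy.
apply: (le_trans _ (self_similar_ge x n)); apply/ltW/(lt_le_trans Fy)/F_nd.
rewrite -lerBlDl ler_pdivlMr ?exprn_gt0//.
have b0 : 0 < beta ^+ n by rewrite exprn_gt0.
by move: hn; rewrite ltr_pdivlMr ?(lt_trans _ y0)// => /ltW; nra.
Qed.

Lemma self_similar_eq0 x : x <= 0 -> F x = 0.
Proof.
params.
rewrite le_eqVlt => /orP[/eqP ->|/F_lt0//].
have i2 := inv_beta_ge2.
(* At the endpoint the second branch contributes 0, so [F 0 = p * F 0] with [p < 1]. *)
have := F_eq 0; rewrite mul0r (F_lt0 (_ : 0 + 1 - 1 / beta < 0)); last by lra.
by nra.
Qed.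

Lemma self_similar_eq1 x : 1 <= x -> F x = 1.
Proof.
params.
rewrite le_eqVlt => /orP[/eqP <-|/F_gt1//].
have i2 := inv_beta_ge2.
have := F_eq 1; rewrite (F_gt1 (_ : 1 < 1 / beta)); last by lra.
by rewrite addrAC subrr add0r; nra.
Qed.

(** For [y <= 1] the second branch sees [y + 1 - 1 / beta <= 0], because [beta <= 1 / 2], and
    vanishes: each shrinking by [beta] costs exactly a factor [p]. *)
Lemma self_similar_scale x n : x <= 1 -> F (beta ^+ n * x) = p ^+ n * F x.
Proof.
params.
move=> x1; elim: n => [|n IH]; first by rewrite !expr0 !mul1r.
have bn1 : 0 < beta ^+ n <= 1 by rewrite exprn_gt0// exprn_ile1; lra.
have i2 := inv_beta_ge2.
rewrite !exprS -!mulrA -IH.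
set y := beta ^+ n * x; have y1 : y <= 1 by rewrite /y; nra.
rewrite F_eq; have -> : beta * y / beta = y by field; rewrite gt_eqF.
by rewrite (@self_similar_eq0 (y + 1 - 1 / beta)) ?mulr0 ?addr0//; lra.
Qed.

(** Near 1 it is the first branch that is trivial: its argument [1 / beta - y] is at least 1, so
    only the weight [1 - p] remains. *)
Lemma self_similar_tail x n :
  x <= 1 -> 1 - F (1 - beta ^+ n * x) = (1 - p) ^+ n * (1 - F (1 - x)).
Proof.
params.
move=> x1; elim: n => [|n IH]; first by rewrite !expr0 !mul1r.
have bn1 : 0 < beta ^+ n <= 1 by rewrite exprn_gt0// exprn_ile1; lra.
have i2 := inv_beta_ge2.
rewrite !exprS -!mulrA -IH.
set y := beta ^+ n * x; have y1 : y <= 1 by rewrite /y; nra.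
rewrite F_eq; have -> : (1 - beta * y) / beta = 1 / beta - y by field; rewrite gt_eqF.
rewrite self_similar_eq1; last by lra.
by rewrite (_ : 1 / beta - y + 1 - 1 / beta = 1 - y) ; ring.
Qed.

(** The equation splits an increment over length [beta * d] into two over length [d], weighted [p]
    and [1 - p]. If one of them vanishes, the other gains a factor at most [rho]; otherwise scaling
    at the ends of the support helps. *)
Lemma self_similar_modulus n x : F (x + beta ^+ n.+1) - F x <= rho ^+ n.
Proof.
params.
have := contraction_ratio_itv; set r := rho => r01.
have pr : p <= r by rewrite /r /rho le_max lexx.
have qr : 1 - p <= r by rewrite /r /rho le_max lexx orbT.
have i2 := inv_beta_ge2.
elim: n x => [|n IH] x.
  by have := df_ge0 x; have := df_le1 (x + beta ^+ 1); rewrite expr0; lra.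
rewrite exprS; set d := beta ^+ n.+1.
rewrite (F_eq (x + _)) (F_eq x).
have d0 : 0 < d by rewrite exprn_gt0.
have -> : (x + beta * d) / beta = x / beta + d by field; rewrite gt_eqF.
set a := x / beta.
have -> : a + d + 1 - 1 / beta = a + 1 - 1 / beta + d by ring.
set b := a + 1 - 1 / beta.
have rn : 0 <= r ^+ n by rewrite exprn_ge0//; lra.
have IHa := IH a; have IHb := IH b; rewrite -/d in IHa IHb.
have Fa : F a <= F (a + d) by apply: F_nd; lra.
have Fb : F b <= F (b + d) by apply: F_nd; lra.
rewrite [leRHS]exprS.
have [a1|a1] := leP 1 a.
  have : (1 - p) * (F (b + d) - F b) <= r * r ^+ n by apply: ler_pM => //; lra.
  by rewrite (self_similar_eq1 a1) (@self_similar_eq1 (a + d)); lra.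
have [b1|b1] := leP (b + d) 0.
  have : p * (F (a + d) - F a) <= r * r ^+ n by apply: ler_pM => //; lra.
  by rewrite (self_similar_eq0 b1) (@self_similar_eq0 b); lra.
(* In the remaining case [1 - d <= a] and [b <= 0], so the increments are at most the tail at
   [1 - d] and the value at [d]. After weighting, both carry the factor [p * (1 - p)]. *)
have Fa1 : F (a + d) - F a <= (1 - p) ^+ n.+1.
  have := @self_similar_tail 1 n.+1 (lexx _).
  rewrite subrr (self_similar_eq0 (lexx 0)) subr0 !mulr1 => <-.
  have := df_le1 (a + d); have : F (1 - d) <= F a by apply: F_nd; rewrite /b in b1; lra.
  by rewrite -/d; lra.
have Fb1 : F (b + d) - F b <= p ^+ n.+1.
  have := @self_similar_scale 1 n.+1 (lexx _).
  rewrite (self_similar_eq1 (lexx 1)) !mulr1 => <-.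
  have := df_ge0 b; have : F (b + d) <= F d by apply: F_nd; rewrite /b; lra.
  by rewrite -/d; lra.
have pn : p ^+ n <= r ^+ n by rewrite lerXn2r ?nnegrE//; lra.
have qn : (1 - p) ^+ n <= r ^+ n by rewrite lerXn2r ?nnegrE//; lra.
have pn0 : 0 <= p ^+ n by rewrite exprn_ge0//; lra.
have qn0 : 0 <= (1 - p) ^+ n by rewrite exprn_ge0//; lra.
rewrite exprS in Fa1; rewrite exprS in Fb1.
have e1 : p * (F (a + d) - F a) <= p * ((1 - p) * r ^+ n).
  by apply: ler_wpM2l; [lra|apply: (le_trans Fa1); apply: ler_wpM2l; lra].
have e2 : (1 - p) * (F (b + d) - F b) <= (1 - p) * (p * r ^+ n).
  by apply: ler_wpM2l; [lra|apply: (le_trans Fb1); apply: ler_wpM2l; lra].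
have e3 : p * (1 - p) <= p * r by apply: ler_wpM2l; lra.
have e4 : (1 - p) * p <= (1 - p) * r by apply: ler_wpM2l; lra.
have e5 : (p * (1 - p)) * r ^+ n <= p * r * r ^+ n by apply: ler_wpM2r.
have e6 : ((1 - p) * p) * r ^+ n <= (1 - p) * r * r ^+ n by apply: ler_wpM2r.
by lra.
Qed.

Lemma self_similar_continuous : continuous F.
Proof.
params.
move=> x; apply/cvgrPdist_le => e e0.
have [n /ltW hn] := exists_expr_lt contraction_ratio_itv e0.
near=> y; apply: (le_trans _ hn).
have : `|x - y| <= beta ^+ n.+1.
  by near: y; apply: cvgr_dist_le => //; rewrite exprn_gt0.
rewrite ler_norml => /andP[h1 h2].
have := self_similar_modulus n x; have := self_similar_modulus n y.
have : F x <= F (y + beta ^+ n.+1) by apply: F_nd; rewrite -lerBlDl.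
have : F y <= F (x + beta ^+ n.+1).
  by apply: F_nd; rewrite addrC -lerBlDr -opprB lerNl.
by rewrite ler_norml => *; apply/andP; split; lra.
Unshelve. all: by end_near. Qed.

End one_solution.

(** The difference of two solutions vanishes outside the unit interval, so each use of the equation
    shrinks its sup bound by [rho]. *)
Lemma self_similar_unique (F G : R -> R) :
  distribution_function F -> Feq beta p F ->
  distribution_function G -> Feq beta p G -> F = G.
Proof.
params.
move=> Fd FE Gd GE.
have dist n : forall x, `|F x - G x| <= rho ^+ n.
  elim: n => [|n IH] x.
    have := df_ge0 Fd x; have := df_le1 Fd x.
    have := df_ge0 Gd x; have := df_le1 Gd x.
    by rewrite expr0 ler_norml => *; apply/andP; split; lra.
  rewrite FE GE exprS.
  have := @self_similar_contraction (fun x => F x - G x) _ _ _ IH x.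
  rewrite [X in `|X|](_ : _ = p * F (x / beta) +
    (1 - p) * F (x / beta + 1 - 1 / beta) - (p * G (x / beta) +
    (1 - p) * G (x / beta + 1 - 1 / beta))); last by ring.
  apply=> y hy.
    by rewrite (self_similar_eq0 Fd FE hy) (self_similar_eq0 Gd GE hy) subrr.
  by rewrite (self_similar_eq1 Fd FE hy) (self_similar_eq1 Gd GE hy) subrr.
apply/funext => x; apply/eqP; rewrite -subr_eq0 -normr_le0.
by apply: (le_expr_le0 contraction_ratio_itv) => n; exact: dist.
Qed.

(** Reflection exchanges the two branches, hence [p] and [1 - p]. It turns right continuity into
    left continuity, so the continuity of [F] enters here. *)
Lemma self_similar_reflection (F : R -> R) :
  distribution_function F -> Feq beta p F ->
  distribution_function (fun x => 1 - F (1 - x)) /\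
  Feq beta (1 - p) (fun x => 1 - F (1 - x)).
Proof.
move=> Fd FE; have [F_nd _ _ _] := Fd.
have Gc : continuous (fun x : R => 1 - F (1 - x)).
  move=> x; apply: cvgB; first exact: cvg_cst.
  apply: (@continuous_comp _ _ _ (fun y : R => 1 - y) F).
    by apply: cvgB; [exact: cvg_cst|exact: cvg_id].
  exact: (self_similar_continuous Fd FE).
split; first split.
- by move=> x y xy; rewrite lerD2l lerN2 F_nd// lerD2l lerN2.
- by move=> x; apply: cvg_at_right_filter; exact: Gc.
- apply/cvgrPdist_le => e e0; near=> x.
  rewrite (self_similar_eq1 Fd FE) ?subrr ?normr0 ?(ltW e0)//.
  by rewrite lerBrDr gerDl; near: x; exact/nbhs_ninfty_le/num_real.
- apply/cvgrPdist_le => e e0; near=> x.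
  rewrite (self_similar_eq0 Fd FE) ?subr0 ?subrr ?normr0 ?(ltW e0)//.
  by rewrite subr_le0; near: x; exact/nbhs_pinfty_ge/num_real.
move=> x; rewrite FE.
have -> : (1 - x) / beta + 1 - 1 / beta = 1 - x / beta by rewrite mulrBl; ring.
have -> : 1 - (x / beta + 1 - 1 / beta) = (1 - x) / beta by rewrite mulrBl; ring.
by ring.
Unshelve. all: by end_near. Qed.

End self_similar.

(** * The periodic factor *)

Section periodic_factor.
Variables (R : realType) (beta p : R).
Hypotheses (beta_gt0 : 0 < beta) (beta_lt1 : beta < 1) (p_gt0 : 0 < p).
Hypothesis F_scale :
  forall x n, x <= 1 -> F_ beta p (beta ^+ n * x) = p ^+ n * F_ beta p x.

Let L : R := `|ln beta|.
Let g (t : R) : R := expR (- t * ln p / ln beta) * F_ beta p (expR t).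

Let ln_beta_lt0 : ln beta < 0.
Proof. by rewrite ln_lt0// beta_gt0. Qed.

Let LE : L = - ln beta. Proof. by rewrite /L ltr0_norm. Qed.

Let L_gt0 : 0 < L. Proof. by rewrite LE oppr_gt0. Qed.

Let expR_shift (a : R) j : expR (a - j%:R * L) = beta ^+ j * expR a.
Proof.
rewrite expRD LE mulrN opprK mulrC; congr (_ * _).
by rewrite expRM_natl lnK.
Qed.

Let g_shift (s : R) j : s <= 0 -> g (s - j%:R * L) = g s.
Proof.
move=> s0; rewrite /g expR_shift F_scale; last by rewrite -expR0 ler_expR.
have -> : - (s - j%:R * L) * ln p / ln beta = - s * ln p / ln beta - j%:R * ln p.
  by rewrite LE; field; rewrite lt_eqF.
have -> : expR (- s * ln p / ln beta - j%:R * ln p) =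
    expR (- s * ln p / ln beta) / p ^+ j.
  by rewrite expRD expRN expRM_natl lnK.
by field; rewrite gt_eqF// exprn_gt0.
Qed.

Let g_shift_eq t i j :
  t - i%:R * L <= 0 -> t - j%:R * L <= 0 -> g (t - i%:R * L) = g (t - j%:R * L).
Proof.
move=> hi hj; rewrite -(g_shift j hi) -(g_shift i hj); congr g; ring.
Qed.

(** A witness for [xget] comes from shifting [t] back by enough periods to reach the half-line of
    the formula; the scaling of [F_] makes the value independent of their number. *)
Lemma nu_spec : periodic (nu_ beta p) `|ln beta| /\
  forall t, t <= 0 -> nu_ beta p t = g t.
Proof.
rewrite /nu_; apply: (@xgetPex _ (fun=> 0) [set nu | periodic nu `|ln beta| /\
    forall t, t <= 0 ->
      nu t = expR (- t * ln p / ln beta) * F_ beta p (expR t)]).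
pose k (t : R) := (Num.truncn (`|t| / L)).+1.
have hk (t : R) : t - (k t)%:R * L <= 0.
  rewrite subr_le0 -ler_pdivrMr//; apply/ltW/(le_lt_trans _ (truncnS_gt _)).
  by rewrite ler_pM2r ?invr_gt0// ler_norm.
exists (fun t : R => g (t - (k t)%:R * L)); split => [t|t t0]; last exact: g_shift.
(* For [t < 0] the count [k] need not grow by one over a period, so two different shifts of [t] have
   to be compared. *)
have e : t + L - (k (t + L))%:R * L = t - (k (t + L)).-1%:R * L.
  by rewrite /k /= -natr1; ring.
rewrite -/L e; apply: g_shift_eq; last exact: hk.
by rewrite -e; exact: hk.
Qed.

(** Points [y > 1] are reached by periodicity: [m] periods move [ln y] to a nonpositive argument,
    where the exponential in the formula cancels the power up to [p ^+ m]. *)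
Lemma powR_nu y m : 0 < y -> beta ^+ m * y <= 1 ->
  y `^ (ln p / ln beta) * nu_ beta p (ln y) = F_ beta p (beta ^+ m * y) / p ^+ m.
Proof.
move=> y0 y1; have [per nuE] := nu_spec.
have b0 : 0 < beta ^+ m * y by rewrite mulr_gt0// exprn_gt0.
have e : ln (beta ^+ m * y) = ln y - m%:R * L.
  by rewrite lnM ?posrE ?exprn_gt0// lnXn// LE -mulr_natr; ring.
have -> : nu_ beta p (ln y) = nu_ beta p (ln (beta ^+ m * y)).
  rewrite e; elim: m {y1 b0 e} => [|m IH]; first by rewrite mul0r subr0.
  by rewrite IH -[in RHS]per -/L; congr nu_; rewrite -(natr1 m); ring.
rewrite nuE; last by rewrite ln_le0.
rewrite /g lnK ?posrE// /powR gt_eqF// mulrA -expRD e.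
rewrite (_ : _ + _ = - (m%:R * ln p)).
  by rewrite expRN expRM_natl lnK// mulrC.
by rewrite LE; field; rewrite lt_eqF.
Qed.

End periodic_factor.

(** Without a solution [F_] would be the default zero function, which is no cdf since a cdf tends to
    1. The law of [X] thus supplies existence. *)
Lemma F_spec_of_cdf (R : realType) (beta p : R) (d : measure_display)
    (T : measurableType d) (P : probability T R) (X : {RV P >-> R}) :
  (forall x : R, cdf X x = (F_ beta p x)%:E) ->
  distribution_function (F_ beta p) /\ Feq beta p (F_ beta p).
Proof.
move=> XF.
have [ex|nex] := pselect (exists F : R -> R,
  [set F | distribution_function F /\ Feq beta p F] F).
  exact: (xgetPex (fun=> 0) ex).
have F0 x : F_ beta p x = 0 by rewrite /F_ xgetPN// => F h; apply: nex; exists F.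
have X1 := cvg_cdfy1 X.
have X0 : cdf X x @[x --> +oo] --> 0%E.
  by rewrite (_ : cdf X = cst 0%E); [exact: cvg_cst|apply/funext => x; rewrite XF F0].
have : 1%E = 0%E :> \bar R by exact: (cvg_unique _ X1 X0).
by move=> /eqP; rewrite onee_eq0.
Qed.

(** * Survival below a high level *)

(** The upper bound combines [expR (- c) * (1 + c) <= 1] with
    [(1 - c + c ^+ 2) * (1 + c) = 1 + c ^+ 3]. *)
Lemma expRN_linear_bound (R : realType) (c : R) :
  0 <= c -> 0 <= expR (- c) - (1 - c) <= c ^+ 2.
Proof.
move=> c0; have h1 := expR_ge1Dx (- c); have h2 := expR_ge1Dx c.
have h3 : expR (- c) * expR c = 1 by rewrite -expRD addNr expR0.
have h4 := expR_ge0 (- c).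
have h5 : expR (- c) * (1 + c) <= 1 by rewrite -[leRHS]h3 ler_wpM2l.
have h6 : (expR (- c) - (1 - c + c ^+ 2)) * (1 + c) <= 0.
  have : 0 <= c ^+ 3 by rewrite exprn_ge0.
  have -> : (expR (- c) - (1 - c + c ^+ 2)) * (1 + c) =
    expR (- c) * (1 + c) - 1 - c ^+ 3 by ring.
  by lra.
move: h6; rewrite pmulr_lle0; last by lra.
by move=> h6; apply/andP; split; lra.
Qed.

(** Errors only add up, because [1 - c] and the exponential lie in [[0, 1]]: each step pays [B],
    plus [c ^+ 2] for replacing [1 - c] by [expR (- c)], and the first [N] steps pay [A] on top. *)
Lemma perturbed_geometric (R : realType) (phi : nat -> R) (c A B : R) (N : nat) :
  0 <= c <= 1 -> 0 <= A -> 0 <= B -> phi 0%N = 1 ->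
  (forall k, (k < N)%N -> `|phi k.+1 - (1 - c) * phi k| <= A) ->
  (forall k, (N <= k)%N -> `|phi k.+1 - (1 - c) * phi k| <= B) ->
  forall K, `|phi K - expR (- (c * K%:R))| <= N%:R * A + K%:R * (B + c ^+ 2).
Proof.
move=> c01 A0 B0 phi0 hA hB K.
have c2 : 0 <= c ^+ 2 by rewrite exprn_ge0//; lra.
(* [minn K N] counts the early steps made so far, which makes the bound inductive. *)
suff h : `|phi K - expR (- (c * K%:R))| <=
    (minn K N)%:R * A + K%:R * (B + c ^+ 2).
  by apply: (le_trans h); rewrite lerD2r ler_wpM2r// ler_nat geq_minr.
elim: K => [|K IH].
  by rewrite min0n mulr0 oppr0 expR0 phi0 subrr normr0 !mul0r addr0.
have -> : expR (- (c * K.+1%:R)) = expR (- c) * expR (- (c * K%:R)).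
  by rewrite -expRD -natr1; congr expR; ring.
set e := expR (- (c * K%:R)) in IH *.
have e1 : 0 <= e <= 1.
  by rewrite expR_ge0 expR_le1 oppr_le0 mulr_ge0//; lra.
have cb := @expRN_linear_bound _ c ltac:(lra).
have -> : phi K.+1 - expR (- c) * e = (phi K.+1 - (1 - c) * phi K) +
  (1 - c) * (phi K - e) - (expR (- c) - (1 - c)) * e by ring.
have h1 : `|(1 - c) * (phi K - e)| <= `|phi K - e|.
  by rewrite normrM ler_piMl// ger0_norm; lra.
have h2 : `|(expR (- c) - (1 - c)) * e| <= c ^+ 2.
  rewrite ger0_norm; last by apply: mulr_ge0; lra.
  by apply: (@le_trans _ _ (c ^+ 2 * 1)); [apply: ler_pM; lra|lra].
have h3 : `|phi K.+1 - (1 - c) * phi K| <=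
    ((minn K.+1 N)%:R - (minn K N)%:R) * A + B.
  have [KN|NK] := ltnP K N.
    rewrite (minn_idPl KN) -natr1.
    by have := hA _ KN; lra.
  rewrite (minn_idPr (leqW NK)) subrr mul0r add0r.
  exact: hB.
apply: (le_trans (ler_normB _ _)).
apply: (le_trans (lerD (ler_normD _ _) (lexx _))).
by rewrite -natr1; lra.
Qed.

(* For the chain X_{k+1} = beta X_k + eps_{k+1} whose initial distribution
   function is F, [joint_cdf beta p u F k t] is the probability that
   X_0, ..., X_{k-1} <= u and X_k <= t. *)
Fixpoint joint_cdf (R : realType) (beta p u : R) (F : R -> R) (k : nat) (t : R)
    : R :=
  if k is j.+1 then
    p * joint_cdf beta p u F j (Num.min u (t / beta)) +
    (1 - p) * joint_cdf beta p u F j (Num.min u (t / beta + 1 - 1 / beta))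
  else F t.

Section joint_cdf.
Variables (R : realType) (beta p u : R) (F : R -> R).
Hypotheses (beta_gt0 : 0 < beta) (beta_le : beta <= 1 / 2).
Hypotheses (p_gt0 : 0 < p) (p_lt1 : p < 1) (u_le1 : u <= 1).
Hypotheses (F_df : distribution_function F) (F_eq : Feq beta p F).

Let rho := Num.max p (1 - p).
Let G := joint_cdf beta p u F.
Let F_nd : {homo F : x y / x <= y}. Proof. by case: F_df. Qed.

Local Ltac params :=
  have ? := inv_beta_ge2 beta_gt0 beta_le;
  move: (beta_gt0) (beta_le) (p_gt0) (p_lt1) (u_le1) => ? ? ? ? ?.

Lemma joint_cdfS k t : G k.+1 t =
  p * G k (Num.min u (t / beta)) +
  (1 - p) * G k (Num.min u (t / beta + 1 - 1 / beta)).
Proof. by []. Qed.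

(** Killing above [u] only removes mass from the stationary law. *)
Lemma joint_cdf_increment k s t :
  s <= t -> 0 <= G k t - G k s <= F t - F s.
Proof.
params; elim: k s t => [|k IH] s t st.
  by rewrite /G /= lexx andbT subr_ge0 F_nd.
have trunc a b : a <= b ->
    0 <= G k (Num.min u b) - G k (Num.min u a) <= F b - F a.
  move=> ab; have mab : Num.min u a <= Num.min u b.
    by rewrite le_min !ge_min lexx ab orbT.
  have /andP[-> h] := IH _ _ mab; apply: (le_trans h).
  have [ua|ua] := leP u a.
    by rewrite (min_idPl (le_trans ua ab)) subrr subr_ge0 F_nd.
  by rewrite lerD2r F_nd// ge_min lexx orbT.
have stb : s / beta <= t / beta by rewrite ler_pM2r ?invr_gt0.
have /andP[h1 h2] := trunc _ _ stb.
have /andP[h3 h4] := trunc (s / beta + 1 - 1 / beta) (t / beta + 1 - 1 / beta) ltac:(lra).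
rewrite !joint_cdfS (F_eq t) (F_eq s).
set Fa := F (t / beta) in h2 *; set Fb := F (s / beta) in h2 *.
set Fc := F (_ + _ - _) in h4 *; set Fd := F (s / beta + _ - _) in h4 *.
set a := G k _ in h1 h2 *; set b := G k (Num.min u (s / beta)) in h1 h2 *.
set c := G k _ in h3 h4 *; set e := G k (Num.min u (s / beta + 1 - 1 / beta)) in h3 h4 *.
have := ler_wpM2l (ltW p_gt0) h1; have := ler_wpM2l (ltW p_gt0) h2.
have q0 : 0 <= 1 - p by lra.
have := ler_wpM2l q0 h3; have := ler_wpM2l q0 h4.
by move=> *; apply/andP; split; lra.
Qed.

Lemma joint_cdf_nd k s t : s <= t -> G k s <= G k t.
Proof. by move=> /(joint_cdf_increment k)/andP[]; rewrite subr_ge0. Qed.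

Lemma joint_cdf_eq0 k t : t <= 0 -> G k t = 0.
Proof.
params; elim: k t => [|k IH] t t0.
  exact: (self_similar_eq0 beta_gt0 beta_le p_gt0 p_lt1 F_df F_eq).
have tb : t / beta <= 0 by rewrite pmulr_lle0 ?invr_gt0.
rewrite joint_cdfS !IH ?mulr0 ?addr0// ge_min ?tb ?orbT//.
by apply/orP; right; lra.
Qed.

(** Beyond 1 both truncations return [u]. Hence [G k 1] is the probability of surviving the times
    [0, ..., k - 1]. *)
Lemma joint_cdf_succ_ge1 k t : 1 <= t -> G k.+1 t = G k u.
Proof.
params => t1; have tb : 1 / beta <= t / beta by rewrite ler_pM2r ?invr_gt0.
rewrite joint_cdfS !(min_idPl _); [ring|lra|lra].
Qed.

Lemma joint_cdf_ge1 k t : 1 <= t -> G k t = G k 1.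
Proof.
case: k => [|k] t1; last by rewrite !joint_cdf_succ_ge1.
have F1 := self_similar_eq1 beta_gt0 beta_le p_gt0 p_lt1 F_df F_eq.
by rewrite /G /= (F1 _ t1) F1.
Qed.

Lemma joint_cdf_le k t : G k t <= G k 1.
Proof.
have [t1|/ltW t1] := leP 1 t; first by rewrite joint_cdf_ge1.
exact: joint_cdf_nd.
Qed.

Lemma joint_cdf_bounds k t : 0 <= G k t <= 1.
Proof.
have ge0 j s : 0 <= G j s.
  have [s0|/ltW s0] := leP s 0; first by rewrite joint_cdf_eq0.
  by rewrite -(joint_cdf_eq0 j (lexx 0)) joint_cdf_nd.
rewrite ge0 (le_trans (joint_cdf_le k t))//=.
elim: k {t} => [|k IH]; first by rewrite /G /= (df_le1 F_df).
by rewrite joint_cdf_succ_ge1// (le_trans _ IH)// joint_cdf_le.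
Qed.

Lemma joint_cdf_drop k : 0 <= G k 1 - G k u <= 1 - F u.
Proof.
have := joint_cdf_increment k u_le1.
by rewrite (self_similar_eq1 beta_gt0 beta_le p_gt0 p_lt1 F_df F_eq (lexx 1)).
Qed.

(** Each step loses at most the stationary tail; this allows survival probabilities [i] steps apart
    to be exchanged. *)
Lemma joint_cdf_drops k i :
  0 <= G k 1 - G (k + i)%N 1 <= i%:R * (1 - F u).
Proof.
elim: i => [|i IH]; first by rewrite addn0 subrr mul0r lexx.
rewrite addnS joint_cdf_succ_ge1//.
have := joint_cdf_drop (k + i)%N; move: IH => /andP[? ?] /andP[? ?].
by rewrite -natr1; apply/andP; split; lra.
Qed.

(* Quasi-stationarity: given survival, the state is still distributed almost
   according to [F]; each step loses at most [1 - F u] while the one-step map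
   contracts the error. *)
Lemma joint_cdf_quasi_stationary k t :
  `|G k t - G k 1 * F t| <= (1 - F u) / (1 - rho).
Proof.
params; have /andP[r0 r1] := contraction_ratio_itv p_gt0 p_lt1; rewrite -/rho in r0 r1.
have F1 := self_similar_eq1 beta_gt0 beta_le p_gt0 p_lt1 F_df F_eq.
have F0 := self_similar_eq0 beta_gt0 beta_le p_gt0 p_lt1 F_df F_eq.
have D0 : 0 <= 1 - F u by rewrite subr_ge0 (df_le1 F_df).
(* The fixed point of [s |-> rho * s + (1 - F u)]: contraction plus the killing of one step. *)
set B := (1 - F u) / (1 - rho).
have B0 : 0 <= B by apply: divr_ge0; lra.
have BE : rho * B + (1 - F u) = B by rewrite /B; field; lra.
elim: k t => [|k IH] t.
  by rewrite /G /= (F1 1 (lexx 1)) mul1r subrr normr0.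
have cut a : 0 <= G k a - G k (Num.min u a) <= G k 1 - G k u.
  have [ua|ua] := leP u a.
    have := joint_cdf_le k a; have := joint_cdf_nd k ua.
    by move=> *; apply/andP; split; lra.
  by rewrite subrr lexx; have /andP[] := joint_cdf_drop k.
have h : `|p * (G k (t / beta) - G k 1 * F (t / beta)) +
    (1 - p) * (G k (t / beta + 1 - 1 / beta) -
               G k 1 * F (t / beta + 1 - 1 / beta))| <= rho * B.
  apply: (@self_similar_contraction _ _ _ beta_gt0 beta_le p_gt0 p_lt1
    (fun s => G k s - G k 1 * F s)) => // s hs.
    by rewrite joint_cdf_eq0// F0// mulr0 subrr.
  by rewrite joint_cdf_ge1// F1// mulr1 subrr.
rewrite joint_cdfS joint_cdf_succ_ge1//.
have := cut (t / beta); have := cut (t / beta + 1 - 1 / beta).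
have := joint_cdf_drop k; have := df_ge0 F_df t; have := df_le1 F_df t.
rewrite (F_eq t); move: h.
set a := G k (t / beta); set b := G k (t / beta + 1 - 1 / beta).
set a' := G k (Num.min _ (t / beta)).
set b' := G k (Num.min _ (t / beta + 1 - 1 / beta)).
set Fa := F (t / beta); set Fb := F (t / beta + 1 - 1 / beta).
set f1 := G k 1; set f2 := G k u => h Ft1 Ft0 /andP[d1 d2] /andP[b1 b2] /andP[a1 a2].
rewrite -BE; set Ft := p * Fa + (1 - p) * Fb in Ft0 Ft1 *.
(* A contracted error plus a killing term. The latter is a difference of two quantities in
   [[0, f1 - f2]], so it costs [f1 - f2] only once. *)
have -> : p * a' + (1 - p) * b' - f2 * Ft =
  (p * (a - f1 * Fa) + (1 - p) * (b - f1 * Fb)) +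
  ((f1 - f2) * Ft - (p * (a - a') + (1 - p) * (b - b'))) by rewrite /Ft; ring.
apply: (le_trans (ler_normD _ _)); apply: lerD => //.
apply: (@le_trans _ _ (f1 - f2)) => //.
have e1 : 0 <= (f1 - f2) * Ft by apply: mulr_ge0.
have e2 : (f1 - f2) * Ft <= f1 - f2 by rewrite ler_piMr.
have e3 : 0 <= p * (a - a') by apply: mulr_ge0; lra.
have e4 : p * (a - a') <= p * (f1 - f2) by apply: ler_wpM2l; lra.
have e5 : 0 <= (1 - p) * (b - b') by apply: mulr_ge0; lra.
have e6 : (1 - p) * (b - b') <= (1 - p) * (f1 - f2) by apply: ler_wpM2l; lra.
by rewrite ler_norml; apply/andP; split; lra.
Qed.

End joint_cdf.

(** * Exponential survival below the level [1 - beta ^+ N * z] *)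

Section exceedance.
Variables (R : realType) (beta p z : R) (F : R -> R) (N : nat).
Hypotheses (beta_gt0 : 0 < beta) (beta_le : beta <= 1 / 2).
Hypotheses (p_gt0 : 0 < p) (p_lt1 : p < 1) (z_gt0 : 0 < z) (z_le1 : z <= 1).
Hypotheses (F_df : distribution_function F) (F_eq : Feq beta p F).
Hypothesis (N_gt0 : (0 < N)%N).

Let rho := Num.max p (1 - p).
Let u := 1 - beta ^+ N * z.
Let G := joint_cdf beta p u F.
Let c := p * (1 - F (1 - z)) * (1 - p) ^+ N.

Local Ltac params :=
  have ? := inv_beta_ge2 beta_gt0 beta_le;
  move: (beta_gt0) (beta_le) (p_gt0) (p_lt1) (z_gt0) (z_le1) => ? ? ? ? ? ?.

Let bN_gt0 n : 0 < beta ^+ n. Proof. by rewrite exprn_gt0. Qed.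
Let bN_le1 n : beta ^+ n <= 1.
Proof. by params; rewrite exprn_ile1//; lra. Qed.

Let u_le1 : u <= 1. Proof. by rewrite gerBl mulr_ge0// ltW. Qed.

(** The branch of innovation 0 is cut at [u] and gives a term free of [s], which cancels in
    differences; the other branch is not cut because [1 - s <= u]. *)
Let G_step k s : beta ^+ N * z <= s <= 1 ->
  G k.+1 (1 - beta * s) = p * G k u + (1 - p) * G k (1 - s).
Proof.
params => /andP[s1 s2]; rewrite /G joint_cdfS.
have -> : (1 - beta * s) / beta = 1 / beta - s by field; lra.
have -> : 1 / beta - s + 1 - 1 / beta = 1 - s by ring.
rewrite (min_idPl _); last by have := u_le1; lra.
by rewrite (min_idPr _)// /u; lra.
Qed.

(* An exceedance of [u] forces the last [N] innovations to be [1 - beta]. *)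
Let G_run k i : (i <= N)%N ->
  G (k + i)%N (1 - beta ^+ i.+1 * z) - G (k + i)%N (1 - beta ^+ i * z) =
  (1 - p) ^+ i * (G k (1 - beta * z) - G k (1 - z)).
Proof.
params; elim: i => [|i IH] iN; first by rewrite addn0 expr1 !expr0 !mul1r.
have bnd j : (j <= N)%N -> beta ^+ N * z <= beta ^+ j * z <= 1.
  move=> jN; rewrite ler_pM2r// ler_wiXn2l//=; [|lra..].
  by rewrite -[leRHS]mulr1; apply: ler_pM => //; apply: ltW.
rewrite addnS [in beta ^+ i.+2]exprS [in X in _ - G _ (1 - X * z)]exprS -!mulrA.
rewrite !G_step ?bnd// ?(ltnW iN)// [(1 - p) ^+ i.+1]exprS -mulrA -(IH (ltnW iN)).
by ring.
Qed.

(** From a state at most [u] one step leads at most to [beta * u + 1 - beta = 1 - beta ^+ N.+1 * z].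
    No mass lies beyond that point, so the run identity at [i = N] captures the whole loss. *)
Lemma exceedance_drop k : G (k + N)%N 1 - G (k + N)%N u =
  (1 - p) ^+ N * (G k (1 - beta * z) - G k (1 - z)).
Proof.
rewrite -(G_run k (leqnn N)) -/u; congr (_ - _).
(* As [N > 0], the time [k + N] is a successor and [G_step] applies with [s = beta ^+ N * z], for
   which [1 - s = u]. *)
rewrite -(prednK N_gt0) addnS (prednK N_gt0) exprS -mulrA.
rewrite [RHS]G_step; last by rewrite lexx mulr_ile1 ?bN_le1// ltW.
rewrite {1}/G (joint_cdf_succ_ge1 F beta_gt0 beta_le p_gt0 p_lt1 u_le1)//.
by rewrite -/G -/u; ring.
Qed.

Let T := 1 - F (1 - z).

Let T01 : 0 <= T <= 1.
Proof.
have := df_ge0 F_df (1 - z); have := df_le1 F_df (1 - z).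
by rewrite /T => *; apply/andP; split; lra.
Qed.

Let uE : 1 - F u = (1 - p) ^+ N * T.
Proof. exact: (self_similar_tail beta_gt0 beta_le p_gt0 p_lt1 F_df F_eq). Qed.

(** The exact loss looks [N] steps back, so the first [N] steps have only the crude error
    [(1 - p) ^+ N]. In the later error, [2 / (1 - rho)] comes from two uses of quasi-stationarity,
    [N] from the survival probability [N] steps back, and 1 from [c ^+ 2]. *)
Lemma exceedance_survival K :
  `|G K 1 - expR (- (c * K%:R))| <=
  N%:R * (1 - p) ^+ N +
  K%:R * ((2 / (1 - rho) + N%:R + 1) * ((1 - p) ^+ N) ^+ 2).
Proof.
params; have /andP[r0 r1] := contraction_ratio_itv p_gt0 p_lt1; rewrite -/rho in r0 r1.
set d := (1 - p) ^+ N; have d0 : 0 <= d by apply: exprn_ge0; lra.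
have d1 : d <= 1 by apply: exprn_ile1; lra.
have /andP[T0 T1] := T01.
have pT : 0 <= p * T <= 1 by apply/andP; split; [apply: mulr_ge0|apply: mulr_ile1]; lra.
have cE : c = p * T * d by [].
have c0 : 0 <= c by rewrite cE; apply: mulr_ge0; lra.
have cd : c <= d by rewrite cE; apply: ler_piMl; lra.
have Dd : 1 - F u <= d by rewrite uE; apply: ler_piMr.
have D0 : 0 <= 1 - F u by rewrite uE; apply: mulr_ge0.
set B := 2 / (1 - rho) * d ^+ 2 + N%:R * d ^+ 2.
have d2 : 0 <= d ^+ 2 by apply: exprn_ge0.
have i0 : 0 <= 2 / (1 - rho) by apply: divr_ge0; lra.
have B0 : 0 <= B by apply: addr_ge0; apply: mulr_ge0.
have GS k : G k.+1 1 - (1 - c) * G k 1 = c * G k 1 - (G k 1 - G k u).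
  by rewrite /G (joint_cdf_succ_ge1 F beta_gt0 beta_le p_gt0 p_lt1 u_le1)//; ring.
have Gb k t : 0 <= G k t <= 1.
  exact: (joint_cdf_bounds beta_gt0 beta_le p_gt0 p_lt1 u_le1 F_df F_eq).
have drop k : 0 <= G k 1 - G k u <= 1 - F u.
  exact: (joint_cdf_drop beta_gt0 beta_le p_gt0 p_lt1 u_le1 F_df F_eq).
have early k : `|G k.+1 1 - (1 - c) * G k 1| <= d.
  have /andP[g0 g1] := Gb k 1; have /andP[e0 e1] := drop k.
  have h1 : 0 <= c * G k 1 by apply: mulr_ge0.
  have h2 : c * G k 1 <= c by apply: ler_piMr.
  by rewrite GS ler_norml; apply/andP; split; lra.
have late k : (N <= k)%N -> `|G k.+1 1 - (1 - c) * G k 1| <= B.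
  move=> Nk; rewrite GS -(subnK Nk) exceedance_drop; set j := (k - N)%N.
  have qs := joint_cdf_quasi_stationary beta_gt0 beta_le p_gt0 p_lt1 u_le1
    F_df F_eq j.
  have /andP[l0 l1] := joint_cdf_drops beta_gt0 beta_le p_gt0 p_lt1 u_le1 F_df F_eq j N.
  have := qs (1 - beta * z); have := qs (1 - z).
  rewrite -/G -/rho -/u in l0 l1 *.
  have -> : F (1 - beta * z) = 1 - (1 - p) * T.
    have := self_similar_tail beta_gt0 beta_le p_gt0 p_lt1 F_df F_eq 1 z_le1.
    by rewrite !expr1 -/T; lra.
  have -> : F (1 - z) = 1 - T by rewrite /T; ring.
  set b := (1 - F u) / (1 - rho) => q1 q2.
  have bd : b <= d / (1 - rho) by rewrite ler_pM2r// invr_gt0; lra.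
  set a1 := G j (1 - beta * z) in q2 *; set a2 := G j (1 - z) in q1 *.
  set f1 := G j 1 in q1 q2 l0 l1 *; set f2 := G (j + N)%N 1 in l0 l1 *.
  (* Quasi-stationarity replaces [a1 - a2] by [f1 * (p * T)], which gives the loss [c * f1]; the
     last term passes from [f1] to the current [f2]. *)
  have -> : c * f2 - (1 - p) ^+ N * (a1 - a2) =
    d * ((a2 - f1 * (1 - T)) - (a1 - f1 * (1 - (1 - p) * T))) - c * (f1 - f2).
    by rewrite cE -/d; ring.
  have h1 : `|(a2 - f1 * (1 - T)) - (a1 - f1 * (1 - (1 - p) * T))| <= b + b.
    exact: (le_trans (ler_normB _ _) (lerD q1 q2)).
  apply: (le_trans (ler_normB _ _)); apply: lerD; rewrite normrM ger0_norm//.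
    apply: (@le_trans _ _ (d * (d / (1 - rho) + d / (1 - rho)))).
      by apply: ler_wpM2l => //; lra.
    by rewrite le_eqVlt; apply/orP; left; apply/eqP; field; lra.
  rewrite ger0_norm// expr2 mulrCA; apply: ler_pM => //.
  by apply: (le_trans l1); apply: ler_wpM2l.
have G01 : G 0%N 1 = 1.
  by rewrite /G /= (self_similar_eq1 beta_gt0 beta_le p_gt0 p_lt1 F_df F_eq).
have := perturbed_geometric (phi := fun k => G k 1) (N := N) _ d0 B0 G01
  (fun k _ => early k) late K.
move=> /(_ ltac:(by rewrite c0 (le_trans cd)))/le_trans; apply.
rewrite lerD2l ler_wpM2l// /B.
have : c ^+ 2 <= d ^+ 2 by rewrite lerXn2r.
by lra.
Qed.

End exceedance.

(** * Law of the running maximum *)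

(** The innovations take their two values only almost surely: the part of [E] outside [U] and [V] is
    null, not empty. *)
Lemma probability_split2 (R : realType) (d : measure_display)
    (T : measurableType d) (P : probability T R) (U V E : set T) :
  measurable U -> measurable V -> measurable E -> U `&` V = set0 ->
  (P U + P V = 1)%E -> (P E = P (E `&` U) + P (E `&` V))%E.
Proof.
move=> mU mV mE UV0 UV1; rewrite (measureDI P mE mU) addeC; congr (_ + _)%E.
have mEU : measurable (E `\` U) by exact: measurableD.
rewrite (measureDI P mEU mV).
have -> : (E `\` U) `&` V = E `&` V.
  apply/seteqP; split=> [w [[Ew _] Vw]//|w [Ew Vw]]; split=> //; split=> // Uw.
  by have : (U `&` V) w by []; rewrite UV0.
rewrite [X in (X + _)%E](_ : _ = 0%E) ?add0e//.
apply/eqP; rewrite eq_le measure_ge0 andbT.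
have -> : 0%E = P (~` (U `|` V)).
  by rewrite probability_setC ?measurableU ?measureU ?UV1 ?subee// ; exact: measurableU.
apply: le_measure; rewrite ?inE.
- exact: measurableD.
- by apply: measurableC; exact: measurableU.
- by move=> w [[_ Uw] Vw] [].
Qed.

Section chain.
Variables (R : realType) (beta p u : R) (d : measure_display).
Variables (T : measurableType d) (P : probability T R).
Variables (F : R -> R) (X eps : nat -> {RV P >-> R}).
Hypotheses (beta_gt0 : 0 < beta) (beta_lt1 : beta < 1).
Hypothesis X_rec : forall k w, X k.+1 w = beta * X k w + eps k.+1 w.
Hypothesis eps_indep : mutually_independent (fun k : nat => eps k.+1).
Hypothesis eps0 : forall k : nat, (1 <= k)%N -> P (eps k @^-1` [set 0]) = p%:E.
Hypothesis eps1 : forall k : nat, (1 <= k)%N ->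
  P (eps k @^-1` [set 1 - beta]) = (1 - p)%:E.
Hypothesis X0_indep : independent_of_family (X 0%N) (fun k : nat => eps k.+1).
Hypothesis X0_cdf : forall x : R, cdf (X 0%N) x = (F x)%:E.

Let A k t := [set w | (forall j, (j < k)%N -> X j w <= u) /\ X k w <= t].
Let cyl (s : seq nat) (B : nat -> set R) :=
  \bigcap_(i in [set` s]) (eps i.+1 @^-1` B i).

Let measurable_le k t : measurable [set w | X k w <= t].
Proof.
rewrite (_ : [set w | _] = X k @^-1` `]-oo, t]); first exact: measurable_funPTI.
by apply/seteqP; split=> w /=; rewrite in_itv.
Qed.

Let measurable_A k t : measurable (A k t).
Proof.
rewrite (_ : A k t =
    \bigcap_(j in `I_k) [set w | X j w <= u] `&` [set w | X k w <= t]) //.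
apply: measurableI => //.
by apply: fin_bigcap_measurable => //; exact: finite_II.
Qed.

Let measurable_cyl s B : (forall i, measurable (B i)) -> measurable (cyl s B).
Proof.
move=> mB; apply: fin_bigcap_measurable; first exact: finite_seq.
by move=> i _; exact: measurable_funPTI.
Qed.

Let cyl_cons i s B B' : i \notin s -> {in s, B =1 B'} ->
  cyl (i :: s) B = (eps i.+1 @^-1` B i) `&` cyl s B'.
Proof.
move=> si BB'; apply/seteqP; split=> [w h|w [h1 h2] j /=].
  split; first by apply: h; rewrite /= mem_head.
  by move=> j /= js; rewrite -BB'//; apply: h; rewrite /= inE js orbT.
rewrite inE => /orP[/eqP ->//|js].
by rewrite BB'//; exact: h2.
Qed.

Let sigma_cyl s B : (forall i, measurable (B i)) ->
  sigma_family (fun k : nat => eps k.+1) (cyl s B).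
Proof.
move=> mB.
apply: (@fin_bigcap_measurable _ (g_sigma_algebraType
  (\bigcup_i preimage_set_system [set: T] (eps i.+1) measurable))).
  exact: finite_seq.
move=> i _; apply: sub_sigma_algebra; exists i => //.
by exists (B i) => //; rewrite setTI.
Qed.

(** Carrying an arbitrary cylinder of later innovations makes the induction work: splitting on the
    value of innovation [k.+1] adds one coordinate to the cylinder at time [k]. *)
Lemma chain_joint_cdf k t s B :
  uniq s -> {in s, forall i, (k <= i)%N} -> (forall i, measurable (B i)) ->
  P (A k t `&` cyl s B) = ((joint_cdf beta p u F k t)%:E * P (cyl s B))%E.
Proof.
elim: k t s B => [|k IH] t s B us ks mB.
  rewrite (_ : A 0%N t = X 0%N @^-1` `]-oo, t]); last first.
    by apply/seteqP; split=> [w [_]|w]; rewrite /A /= in_itv.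
  rewrite X0_indep//; last exact: sigma_cyl.
  by rewrite -[P (X 0%N @^-1` _)]/(cdf (X 0%N) t) X0_cdf.
have ks' : k \notin s by apply/negP => /ks; rewrite ltnn.
(* For a fixed innovation the bound on [X k.+1] becomes one on [X k], and together with survival at
   time [k] it yields the minimum in [joint_cdf]. *)
have innov e t' : (forall w, eps k.+1 w = e -> (X k.+1 w <= t) = (X k w <= t')) ->
    P (A k.+1 t `&` cyl s B `&` (eps k.+1 @^-1` [set e])) =
    ((joint_cdf beta p u F k (Num.min u t'))%:E *
     (P (eps k.+1 @^-1` [set e]) * P (cyl s B)))%E.
  move=> ht'; pose B' i := if i == k then [set e] else B i.
  have mB' i : measurable (B' i) by rewrite /B'; case: ifP.
  have B'B : {in s, B' =1 B}.
    by move=> i si; rewrite /B'; case: eqP => // ik; rewrite -ik si in ks'.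
  have uks : uniq (k :: s) by rewrite /= ks'.
  have B'k : B' k = [set e] by rewrite /B' eqxx.
  have -> : A k.+1 t `&` cyl s B `&` (eps k.+1 @^-1` [set e]) =
      A k (Num.min u t') `&` cyl (k :: s) B'.
    rewrite (cyl_cons ks' B'B) B'k; apply/seteqP; split=> w.
      move=> [[[h1 h2] h3] h4]; split=> //; split=> [j jk|].
        by apply: h1; exact: ltnW.
      by rewrite le_min h1//= -ht'.
    move=> [[h1]]; rewrite le_min => /andP[h2 h3] [h4 h5].
    split=> //; split=> //; split=> [j|]; last by rewrite ht'.
    by rewrite ltnS leq_eqVlt => /orP[/eqP ->//|]; exact: h1.
  rewrite IH//; last first.
    by move=> i; rewrite inE => /orP[/eqP ->//|/ks/ltnW].
  congr (_ * _)%E; rewrite /cyl (eps_indep uks mB') big_cons B'k; congr (_ * _)%E.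
  rewrite (eps_indep us mB) big_seq [RHS]big_seq.
  by apply: eq_bigr => i si; rewrite B'B.
have mE : measurable (A k.+1 t `&` cyl s B).
  by apply: measurableI => //; exact: measurable_cyl.
have disj : (eps k.+1 @^-1` [set 0]) `&` (eps k.+1 @^-1` [set 1 - beta]) = set0.
  apply/seteqP; split=> // w [/= -> h].
  by move: beta_lt1; rewrite -subr_gt0 -h ltxx.
rewrite (probability_split2 _ _ mE disj); last first.
- by rewrite eps0// eps1// -EFinD addrC subrK.
- exact: measurable_funPTI.
- exact: measurable_funPTI.
rewrite (innov 0 (t / beta)); last first.
  by move=> w h; rewrite X_rec h addr0 ler_pdivlMr// mulrC.
rewrite (innov (1 - beta) (t / beta + 1 - 1 / beta)); last first.
  move=> w h; rewrite X_rec h.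
  have -> : t / beta + 1 - 1 / beta = (t - (1 - beta)) / beta.
    by field; rewrite gt_eqF.
  by rewrite ler_pdivlMr// lerBrDr mulrC.
rewrite eps0// eps1// !muleA -!EFinM -muleDl//; last first.
  by apply: fin_num_measure; exact: measurable_cyl.
by congr (_ * _)%E; rewrite -EFinD /= mulrC [X in _ + X]mulrC.
Qed.

Lemma chain_running_max k :
  P [set w | running_max (fun k : nat => X k : T -> R) k.+1 w <= u] =
  (joint_cdf beta p u F k u)%:E.
Proof.
have c1 : cyl [::] (fun=> setT) = setT by rewrite /cyl set_nil bigcap_set0.
have := @chain_joint_cdf k u [::] (fun=> setT) isT.
rewrite c1 setIT probability_setT mule1 => <-//.
congr (P _); apply/seteqP; split=> w /=; rewrite /running_max.
  move=> /bigmax_leP[_ h]; split=> [j jk|].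
    by apply: (h (Ordinal (ltnW jk : (j < k.+1)%N))).
  by apply: (h ord_max).
move=> [h1 h2]; have h j : (j <= k)%N -> X j w <= u.
  by rewrite leq_eqVlt => /orP[/eqP ->//|]; exact: h1.
by apply/bigmax_leP; split=> [|i _]; apply: h => //; rewrite -ltnS.
Qed.

End chain.

(** * The limit *)

(** With [r] the square root of [q], the product [n%:R * r ^+ n] stays bounded because an
    exponential exceeds its exponent; the other factor [r ^+ n] tends to 0. *)
Lemma cvg_natmul_expr (R : realType) (q : R) :
  0 < q < 1 -> n%:R * q ^+ n @[n --> \oo] --> (0 : R).
Proof.
move=> /andP[q0 q1]; pose r := Num.sqrt q.
have r0 : 0 < r by rewrite sqrtr_gt0.
have r1 : r < 1 by rewrite -sqrtr1 ltr_sqrt.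
have qE : q = r * r by rewrite -expr2 sqr_sqrtr// ltW.
pose a := - ln r; have a0 : 0 < a by rewrite oppr_gt0 ln_lt0// r0.
have bound n : n%:R * r ^+ n <= a^-1.
  have -> : r ^+ n = (expR (n%:R * a))^-1.
    by rewrite -expRN /a mulrN opprK expRM_natl lnK.
  rewrite ler_pdivrMr ?expR_gt0// mulrC ler_pdivlMr//.
  by apply: le_trans (expR_ge1Dx _); rewrite lerDr.
apply: (@squeeze_cvgr _ _ _ _ (cst 0) (fun n => a^-1 * r ^+ n)).
- apply: nearW => n; rewrite qE exprMn mulrA mulr_ge0 ?mulr_ge0 ?exprn_ge0 ?(ltW r0)//=.
  by rewrite ler_wpM2r ?exprn_ge0// ltW.
- exact: cvg_cst.
- rewrite -[X in _ --> X](mulr0 a^-1); apply: cvgM; first exact: cvg_cst.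
  by apply: cvg_expr; rewrite ger0_norm// ltW.
Qed.

(** The level has [N = n.+1] while the time horizon has exponent [n + m.+1]; the offset [m] is the
    rescaling that brings [- x] to [z <= 1], and it leaves the factor [1 / (1 - p) ^+ m]. *)
Lemma survival_cvg (R : realType) (beta p z : R) (F : R -> R) (m : nat) :
  0 < beta -> beta <= 1 / 2 -> 0 < p -> p < 1 -> 0 < z -> z <= 1 ->
  distribution_function F -> Feq beta p F ->
  joint_cdf beta p (1 - beta ^+ n.+1 * z) F
      (Num.truncn (1 / (1 - p) ^+ (n + m.+1)%N)) 1 @[n --> \oo] -->
    expR (- (p * (1 - F (1 - z)) / (1 - p) ^+ m)).
Proof.
move=> b0 b1 p0 p1 z0 z1 Fd FE.
set q := 1 - p; have q01 : 0 < q < 1 by rewrite /q; apply/andP; split; lra.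
have /andP[q0 q1] := q01.
set pT := p * (1 - F (1 - z)).
have pT01 : 0 <= pT <= 1.
  have := df_ge0 Fd (1 - z); have := df_le1 Fd (1 - z) => h1 h2.
  by apply/andP; split; [apply: mulr_ge0|apply: mulr_ile1]; lra.
have /andP[pT0 pT1] := pT01.
pose K n := Num.truncn (1 / q ^+ (n + m.+1)%N).
have qn0 n : 0 < q ^+ n by rewrite exprn_gt0.
have KE n : 1 / q ^+ m - q ^+ n.+1 <= q ^+ n.+1 * (K n)%:R <= 1 / q ^+ m.
  have ge0 : 0 <= 1 / q ^+ (n + m.+1)%N by apply: divr_ge0 => //; apply: ltW.
  have /andP[] := truncn_itv ge0; rewrite -/(K n) -natr1.
  rewrite -addSnnS exprD => h1 h2.
  have qn := qn0 n.+1; have qm := qn0 m.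
  have e : q ^+ n.+1 * (1 / (q ^+ n.+1 * q ^+ m)) = 1 / q ^+ m.
    by field; rewrite !gt_eqF.
  apply/andP; split; rewrite -e; last by rewrite ler_wpM2l// ltW.
  rewrite lerBlDr -[X in _ <= _ + X]mulr1 -mulrDr.
  by apply: ler_wpM2l; apply: ltW.
set C := 2 / (1 - Num.max p (1 - p)) + 1.
have C0 : 0 <= C.
  have /andP[_ r1] := contraction_ratio_itv p0 p1.
  by apply: addr_ge0 => //; apply: divr_ge0 => //; lra.
(* One factor [q ^+ n.+1] of the quadratic error is spent on
   [q ^+ n.+1 * (K n)%:R <= 1 / q ^+ m]. *)
pose err n := n.+1%:R * q ^+ n.+1 +
  1 / q ^+ m * (C * q ^+ n.+1 + n.+1%:R * q ^+ n.+1).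
have qcvg : q ^+ n.+1 @[n --> \oo] --> (0 : R).
  rewrite (cvg_shiftS (fun n => q ^+ n)); apply: cvg_expr.
  by rewrite ger0_norm// ltW.
have nqcvg : n.+1%:R * q ^+ n.+1 @[n --> \oo] --> (0 : R).
  by rewrite (cvg_shiftS (fun n => n%:R * q ^+ n)); exact: cvg_natmul_expr.
have err0 : err n @[n --> \oo] --> (0 : R).
  have -> : 0 = 0 + 1 / q ^+ m * (C * 0 + 0) :> R by rewrite !(mulr0, addr0).
  apply: cvgD => //; apply: cvgM; first exact: cvg_cst.
  by apply: cvgD => //; apply: cvgM => //; exact: cvg_cst.
have bound n : `|joint_cdf beta p (1 - beta ^+ n.+1 * z) F (K n) 1 -
    expR (- (pT * q ^+ n.+1 * (K n)%:R))| <= err n.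
  apply: (le_trans (exceedance_survival b0 b1 p0 p1 z0 z1 Fd FE (ltn0Sn n) (K n))).
  rewrite /err lerD2l -/q.
  have -> : (K n)%:R * ((2 / (1 - Num.max p q) + n.+1%:R + 1) * q ^+ n.+1 ^+ 2) =
    (q ^+ n.+1 * (K n)%:R) * (C * q ^+ n.+1 + n.+1%:R * q ^+ n.+1).
    by rewrite /C -/q; ring.
  apply: ler_wpM2r; last by have /andP[] := KE n.
  by apply: addr_ge0; apply: mulr_ge0 => //; apply: ltW.
have expcvg : expR (- (pT * q ^+ n.+1 * (K n)%:R)) @[n --> \oo] -->
    expR (- (pT / q ^+ m)).
  apply: continuous_cvg; first exact: continuous_expR.
  apply: cvgN.
  apply: (@squeeze_cvgr _ _ _ _ (fun n => pT / q ^+ m - q ^+ n.+1)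
    (cst (pT / q ^+ m))).
  - apply: nearW => n; have /andP[h1 h2] := KE n; rewrite -mulrA /=.
    have -> : pT / q ^+ m = pT * (1 / q ^+ m) by rewrite mul1r.
    rewrite ler_wpM2l// andbT.
    apply: (@le_trans _ _ (pT * (1 / q ^+ m - q ^+ n.+1))); last exact: ler_wpM2l.
    by rewrite mulrBr lerD2l lerN2 ler_piMl// ltW.
  - by rewrite -[X in _ --> X]subr0; apply: cvgB => //; exact: cvg_cst.
  - exact: cvg_cst.
have -> : (fun n => joint_cdf beta p (1 - beta ^+ n.+1 * z) F
      (Num.truncn (1 / q ^+ (n + m.+1)%N)) 1) =
    (fun n => expR (- (pT * q ^+ n.+1 * (K n)%:R)) +
      (joint_cdf beta p (1 - beta ^+ n.+1 * z) F (K n) 1 -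
       expR (- (pT * q ^+ n.+1 * (K n)%:R)))).
  by apply/funext => n; rewrite [RHS]addrC subrK.
rewrite -[X in _ --> X]addr0; apply: cvgD => //.
apply: norm_cvg0; apply: (@squeeze_cvgr _ _ _ _ (cst 0) err) => //; last exact: cvg_cst.
by apply: nearW => n; rewrite normr_ge0 bound.
Qed.

Theorem theorem3p1 (R : realType) (beta p q : R)
    (hbeta : 0 < beta <= 1 / 2) (hp : 0 < p < 1) (hq : q = 1 - p)
    (hbp : (beta, p) <> (1 / 2, 1 / 2))
    (d : measure_display) (T : measurableType d) (P : probability T R)
    (X eps : nat -> {RV P >-> R})
    (hX : forall (k : nat) (w : T), X k.+1 w = beta * X k w + eps k.+1 w)
    (heps_indep : mutually_independent (fun k : nat => eps k.+1))
    (heps0 : forall k : nat, (1 <= k)%N -> P (eps k @^-1` [set 0]) = p%:E)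
    (heps1 : forall k : nat, (1 <= k)%N ->
      P (eps k @^-1` [set 1 - beta]) = q%:E)
    (hX0_indep : independent_of_family (X 0%N) (fun k : nat => eps k.+1))
    (hX0_cdf : forall x : R, cdf (X 0%N) x = (F_ beta p x)%:E) :
  let M := running_max (fun k : nat => X k : T -> R) in
  let a := fun n : nat => 1 / beta ^+ n in
  let b := fun n : nat => 1 in
  let k := fun n : nat => Num.truncn (1 / q ^+ n) in
  forall x : R, x < 0 ->
    P [set w | a n * (M (k n) w - b n) <= x] @[n --> \oo] -->
      (expR (- (p * (- x) `^ (ln q / ln beta) * nu_ beta q (ln (- x)))))%:E.
Proof.
move=> M a b k x x0; subst q.
have /andP[b0 b1] := hbeta; have /andP[p0 p1] := hp.
have beta_lt1 : beta < 1 by lra.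
have q0 : 0 < 1 - p by lra.
have q1 : 1 - p < 1 by lra.
have [Fd FE] := F_spec_of_cdf hX0_cdf.
have [Gd GE] := self_similar_reflection b0 b1 p0 p1 Fd FE.
have [Fqd FqE] : distribution_function (F_ beta (1 - p)) /\
    Feq beta (1 - p) (F_ beta (1 - p)).
  (* The reflected function is a witness, so [xget] returns a genuine solution, which uniqueness
     then identifies with it. *)
  by apply: (@xgetPex _ (fun=> 0) [set F | distribution_function F /\
    Feq beta (1 - p) F]); exists (fun x => 1 - F_ beta p (1 - x)).
have FqF z : F_ beta (1 - p) z = 1 - F_ beta p (1 - z).
  by rewrite (self_similar_unique b0 b1 q0 q1 Fqd FqE Gd GE).
have y0 : 0 < - x by rewrite oppr_gt0.
(* The survival estimate requires [z <= 1], whereas [- x] is any positive number. *)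
have [m hm] : exists m, beta ^+ m * (- x) <= 1.
  have [||m hm] := @exists_expr_lt _ beta (1 / (- x)).
  - by apply/andP; split; lra.
  - exact: divr_gt0.
  by exists m; move: hm; rewrite ltr_pdivlMr// => /ltW.
rewrite -mulrA (powR_nu b0 beta_lt1 q0 _ y0 hm); last first.
  exact: (self_similar_scale b0 b1 q0 q1 Fqd FqE).
set z := beta ^+ m * (- x) in hm *; rewrite FqF mulrA.
have z0 : 0 < z by rewrite mulr_gt0// exprn_gt0.
(* After this shift the level is [1 - beta ^+ n.+1 * z], with a positive exponent for every [n]. *)
rewrite -(cvg_shiftn m.+1) /=.
have -> : (fun n => P [set w | a (n + m.+1)%N * (M (k (n + m.+1)%N) w -
      b (n + m.+1)%N) <= x]) =
    (fun n => (joint_cdf beta p (1 - beta ^+ n.+1 * z) (F_ beta p)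
      (Num.truncn (1 / (1 - p) ^+ (n + m.+1)%N)) 1)%:E).
  apply/funext => n; set u := 1 - beta ^+ n.+1 * z.
  have u1 : u <= 1 by rewrite gerBl mulr_ge0 ?exprn_ge0 ?ltW.
  have -> : [set w | a (n + m.+1)%N * (M (k (n + m.+1)%N) w -
      b (n + m.+1)%N) <= x] = [set w | M (k (n + m.+1)%N) w <= u].
    have -> : u = 1 - beta ^+ (n + m.+1)%N * (- x).
      by rewrite /u /z mulrA -exprD addSnnS.
    have e v : (a (n + m.+1)%N * (v - b (n + m.+1)%N) <= x) =
        (v <= 1 - beta ^+ (n + m.+1)%N * (- x)).
      by rewrite /a mul1r ler_pdivrMl ?exprn_gt0// lerBlDl mulrN opprK.
    by apply/seteqP; split=> w /=; rewrite e.
  (* The horizon is at least 1, so the running maximum is over a nonempty range and is described by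
     [joint_cdf] at the predecessor [j]. *)
  rewrite /k; have : (0 < Num.truncn (1 / (1 - p) ^+ (n + m.+1)%N))%N.
    by rewrite truncn_gt0 ler_pdivlMr ?exprn_gt0// mul1r exprn_ile1// ltW.
  case: (Num.truncn _) => // j _.
  rewrite (joint_cdf_succ_ge1 _ b0 b1 p0 p1 u1)//.
  exact: (chain_running_max _ b0 beta_lt1 hX heps_indep heps0 heps1 hX0_indep hX0_cdf).
apply: cvg_EFin; first exact: nearW.
exact: (survival_cvg b0 b1 p0 p1 z0 hm Fd FE).
Qed.
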